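(* Let $p$ be an odd prime and $F$ a field containing a primitive $p$th root of unity such that $G_F(p)$ is a finitely generated pro-$p$ group. If there exists a finite extension $K/F$ with $K\subseteq F(p)$ such that $K$ is $p$-rigid, then $F$ is $p$-rigid.
   Context: For a field $L$, $\dot L=L\setminus\{0\}$, $\dot L^p$ the nonzero $p$th powers. An element $b\in\dot L\setminus\dot L^p$ is $p$-rigid if every element of $N_{L(\sqrt[p]{b})/L}(L(\sqrt[p]{b})^\times)$ lies in $\bigcup_{j=0}^{p-1}b^j\dot L^p$; $L$ is $p$-rigid if every element of $\dot L\setminus\dot L^p$ is $p$-rigid. $F(p)$ is the maximal $p$-extension of $F$ (compositum in a separable closure of all finite Galois extensions of $p$-power degree) and $G_F(p)=\mathrm{Gal}(F(p)/F)$. *)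

(* Defs.v *)
From HB Require Import structures.
From mathcomp Require Import all_boot all_order all_algebra all_fingroup all_field.
Set Implicit Arguments. Unset Strict Implicit. Unset Printing Implicit Defensive.
Import GRing.Theory.
Local Open Scope ring_scope.

Definition fnorm (L : fieldType) (E : fieldExtType L) (x : E) : L :=
  \det (passmx.mxof (vbasis fullv) (vbasis fullv) (amulr x)).

(* b is p-rigid: b is not a p-th power, and every norm from L(b^(1/p))^x
   lies in the union of b^j (L^x)^p, 0 <= j <= p-1.  L(b^(1/p)) is any
   extension E of L generated over L by an element a with a^p = b. *)
Definition p_rigid_elt (p : nat) (L : fieldType) (b : L) : Prop :=
  [/\ b != 0, ~ (exists c : L, b = c ^+ p) &
   forall (E : fieldExtType L) (a : E),
     a ^+ p = b%:A -> (<<1; a>>%VS = fullv) ->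
     forall x : E, x != 0 ->
       exists2 j : nat, (j < p)%N &
         exists2 c : L, c != 0 & fnorm x = b ^+ j * c ^+ p].

Definition p_rigid (p : nat) (L : fieldType) : Prop :=
  forall b : L, b != 0 -> ~ (exists c : L, b = c ^+ p) -> p_rigid_elt p b.

(* A finite Galois extension of F of p-power degree (= a finite Galois
   subextension of F(p), up to F-isomorphism). *)
Definition finite_Galois_p_ext (p : nat) (F : fieldType) (L : splittingFieldType F) : Prop :=
  galois 1%VS (fullv : {vspace L}) /\ p.-nat (\dim (fullv : {vspace L})).

(* G_F(p) is (topologically) finitely generated: there is n such that every
   finite quotient Gal(L/F), L/F finite Galois of p-power degree, is
   generated by at most n elements. *)
Definition GFp_fin_gen (p : nat) (F : fieldType) : Prop :=
  exists n : nat, forall L : splittingFieldType F, finite_Galois_p_ext p L ->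
    exists s : seq (gal_of (fullv : {vspace L})),
      (size s <= n)%N /\ (<<[set x in s]>>%g = 'Gal(fullv / 1%VS))%g.

(* Main.v *)
Require Import Defs.
From HB Require Import structures.
From mathcomp Require Import all_boot all_order all_algebra all_fingroup all_field.
From mathcomp Require Import all_solvable ring.
From Stdlib Require Import Classical.
Set Implicit Arguments. Unset Strict Implicit. Unset Printing Implicit Defensive.
Import GRing.Theory.
Local Open Scope ring_scope.

(* Since [F(p)/F] is a pro-[p] extension, one may climb down from [K] to [F] in
   steps [K/F] that are the fixed field extensions of an automorphism [s] of
   order [p].  Write [(b, c) = 0] if [c] is a norm from [F(b^(1/p))]; this
   relation is symmetric, as it says that a cyclic algebra of degree [p] splits.
   Rigidity of [K] says that [(b, c) = 0] forces [b], [c] to be dependent modulo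
   [p]th powers, so that [x + y] lies in [x (y/x)^j K^p] for some [j] whenever
   [y/x] is not a [p]th power.

   Key point: for [K] rigid and [y] in [K], the norm [N y] is a [p]th power in
   [K].  Otherwise the conjugates of [y] are independent in the [F_p]-space
   [K^*/K^p], and by rigidity their sum [t] is congruent to a product of powers
   [s^i(y)^(u_i)] with [sum u_i = 1].  Taking norms, [N t = N y] modulo [p]th
   powers, but [N t = t^p].

   By Kummer theory [K = F(a^(1/p))] and [F /\ K^p = <a> F^p].  The key point
   says that [(a, c) = 0] forces [c] to lie in [<a> F^p].  If [(b, c) = 0] with
   [b] outside [K^p], rigidity of [K] puts [c] in [<a, b> F^p]; were [a] really
   involved, then [(b, a) = 0] and [b] would be a [p]th power in [K]. *)

(** * Radical polynomials and norms from radical extensions *)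

Lemma root_of_coprime_exp (L : fieldType) (p k : nat) (b d : L) :
  (0 < k)%N -> coprime k p -> b ^+ k = d ^+ p -> exists c, b = c ^+ p.
Proof.
move=> k_gt0 /(coprimeP _ k_gt0)[[u v] /= uv] bd.
have uvE : (u * k = (v * p).+1)%N by rewrite -[RHS]add1n -uv subnK // ltnW // -subn_gt0 uv.
have [b0|b0] := eqVneq b 0.
  exists 0; move: bd; rewrite b0 !expr0n; case: (p) k_gt0 => [|m] //; by case: (k).
(* Since [u * k = v * p + 1], [b = b^(u k) / b^(v p) = (d^u / b^v)^p]. *)
exists (d ^+ u / b ^+ v).
have bv0 : b ^+ (v * p) != 0 by rewrite expf_neq0.
apply: (mulIf bv0); rewrite -exprS -uvE mulnC exprM bd expr_div_n -!exprM.
by rewrite (mulnC u) divfK.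
Qed.

Section RadicalPolynomial.

Variables (L : fieldType) (p : nat) (b : L).
Hypotheses (p_pr : prime p) (bNp : ~ exists c : L, b = c ^+ p).

Lemma radicand_neq0 : b != 0.
Proof. by apply/eqP => b0; apply: bNp; exists 0; rewrite expr0n b0 gtn_eqF ?prime_gt0. Qed.

Lemma size_radical_poly : size ('X^p - b%:P) = p.+1.
Proof. by rewrite size_XnsubC ?prime_gt0. Qed.

Lemma radical_poly_neq0 : 'X^p - b%:P != 0.
Proof. by rewrite -size_poly_eq0 size_radical_poly. Qed.

Lemma horner_mx_radical n (A : 'M[L]_n.+1) :
  horner_mx A ('X^p - b%:P) = A ^+ p - b%:M.
Proof. by rewrite rmorphB rmorphXn /= horner_mx_X horner_mx_C. Qed.

(* The companion matrix [A] of a factor of degree [n] satisfies [A^p = b], so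
   [(det A)^p = b^n]; as [b] is not a [p]th power, [p] divides [n]. *)
Lemma radical_poly_irr : irreducible_poly ('X^p - b%:P).
Proof.
split=> [|q szq q_dv]; first by rewrite size_radical_poly ltnS prime_gt0.
have q0 : q != 0 by apply: contraTneq q_dv => ->; rewrite dvd0p radical_poly_neq0.
have lq0 : (lead_coef q)^-1 != 0 by rewrite invr_eq0 lead_coef_eq0.
pose q1 := (lead_coef q)^-1 *: q.
have q1m : q1 \is monic by rewrite monicE lead_coefZ mulVf ?lead_coef_eq0.
have q1q : q1 %= q by apply: eqp_scale.
have q1_dv : q1 %| 'X^p - b%:P by rewrite (eqp_dvdl _ q1q).
have detA n (A : 'M[L]_n) : char_poly A %| 'X^p - b%:P -> \det A ^+ p = b ^+ n.
  case: n A => [|n] A; first by rewrite det_mx00 !expr1n.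
  move=> /(dvdp_trans (mxminpoly_dvd_char A))/mxminpoly_minP.
  rewrite horner_mx_radical => /subr0_eq Ap.
  by rewrite -(det_scalar n.+1) -Ap; elim: (p) => [|k IHk]; rewrite ?det1 // !exprS det_mulmx IHk.
rewrite -(dvdp_size_eqp q_dv) size_radical_poly.
have [d] : exists d, b ^+ (size q1).-1 = d ^+ p.
  by exists (\det (companionmx q1)); rewrite detA ?companionmxK.
rewrite (eqp_size q1q); set n := (size q).-1 => bn.
have n_gt0 : (0 < n)%N by rewrite /n; move: szq q0; rewrite -size_poly_eq0; case: size => [|[]].
have := dvdp_leq radical_poly_neq0 q_dv; rewrite size_radical_poly.
have -> : size q = n.+1 by rewrite prednK // lt0n size_poly_eq0.
rewrite ltnS leq_eqVlt eqSS => /predU1P[->//|n_lt].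
case: bNp; apply: root_of_coprime_exp bn => //.
by rewrite coprime_sym prime_coprime // gtnNdvd.
Qed.

(** Otherwise the irreducible [X^p - b] is coprime to [h], and coprime polynomials share no root in
    any extension. *)
Lemma radical_dvd_root (E : fieldType) (f : {rmorphism L -> E}) (be : E) h :
  be ^+ p = f b -> root (map_poly f h) be -> 'X^p - b%:P %| h.
Proof.
move=> be_p; apply: contraTT; rewrite -(irreducible_poly_coprime _ radical_poly_irr).
rewrite -(coprimep_map f) => /coprimep_root -> //.
by rewrite rootE !rmorphB /= map_polyXn map_polyC /= !hornerE be_p subrr.
Qed.

(** The same alternative for a matrix: if [h] is coprime to [X^p - b], a Bezout relation evaluated
    at [A] and applied to [v] gives [v = 0]. *)
Lemma radical_dvd_mx n (A : 'M[L]_n.+1) (v : 'rV_n.+1) h :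
  A ^+ p = b%:M -> v != 0 -> v *m horner_mx A h = 0 -> 'X^p - b%:P %| h.
Proof.
move=> Ap v0 vh; apply: contraNT v0.
rewrite -(irreducible_poly_coprime _ radical_poly_irr).
case/Bezout_eq1_coprimepP => -[u w] /= uw1.
have := congr1 (horner_mx A) uw1; rewrite rmorphD !rmorphM /= rmorph1.
rewrite horner_mx_radical Ap subrr mulr0 add0r => /(congr1 (mulmx v)).
rewrite (comm_horner_mx2 A w h) -[v *m 1]/(v *m 1%:M) mulmx1.
by rewrite -[horner_mx A h * _]/(horner_mx A h *m _) mulmxA vh mul0mx => <-.
Qed.

End RadicalPolynomial.

(* The product of the conjugates [g(z^j X)], which modulo [X^p - b] represents
   the norm of [g(b^(1/p))]. *)
Definition twisted_norm (L : fieldType) (p : nat) (z : L) (g : {poly L}) : {poly L} :=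
  \prod_(j < p) (g \Po (z ^+ j *: 'X)).

Lemma comp_polyZX (L : fieldType) (z w : L) (g : {poly L}) :
  (g \Po (z *: 'X)) \Po (w *: 'X) = g \Po ((z * w) *: 'X).
Proof. by rewrite -comp_polyA comp_polyZ comp_polyX scalerA. Qed.

Lemma twisted_normS (L : fieldType) (k : nat) (z : L) (g : {poly L}) :
  twisted_norm k.+1 z g = g * (twisted_norm k z g \Po (z *: 'X)).
Proof.
rewrite /twisted_norm big_ord_recl expr0 scale1r comp_polyXr; congr (_ * _).
rewrite (rmorph_prod (comp_poly _)); apply: eq_bigr => i _.
by rewrite /= comp_polyZX -exprSr.
Qed.

Lemma horner_twisted_norm (L E : fieldType) (f : {rmorphism L -> E}) p z g (x : E) :
  (map_poly f (twisted_norm p z g)).[x] =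
    \prod_(j < p) (map_poly f g).[f z ^+ j * x].
Proof.
rewrite rmorph_prod horner_prod; apply: eq_bigr => j _.
by rewrite /= map_comp_poly map_polyZ map_polyX rmorphXn horner_comp !hornerE.
Qed.

Section NormDeterminant.

Variables (L : fieldType) (p : nat) (b z : L).
Hypotheses (p_pr : prime p) (bNp : ~ exists c : L, b = c ^+ p).
Hypothesis z_prim : p.-primitive_root z.

Lemma radical_roots (E : fieldType) (f : {rmorphism L -> E}) (be : E) :
  be ^+ p = f b ->
  let s := [seq f z ^+ (j : 'I_p) * be | j <- enum 'I_p] in
  uniq s /\ 'X^p - (f b)%:P = \prod_(x <- s) ('X - x%:P).
Proof.
move=> be_p s.
have be0 : be != 0.
  apply: contra_neq (radicand_neq0 p_pr bNp) => be0; apply/eqP.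
  by rewrite -(fmorph_eq0 f) -be_p be0 expr0n gtn_eqF ?prime_gt0.
have fz_prim : p.-primitive_root (f z) by rewrite fmorph_primitive_root.
have us : uniq s.
  rewrite map_inj_uniq ?enum_uniq // => i j /(mulIf be0)/eqP.
  by rewrite (eq_prim_root_expr fz_prim) !modn_small // => /eqP/val_inj.
split=> //; have szs : size s = p by rewrite size_map size_enum_ord.
have := all_roots_prod_XsubC (p := 'X^p - (f b)%:P) (rs := s).
rewrite szs size_XnsubC ?prime_gt0 // uniq_rootsE => /(_ erefl _ us) -> //.
  by rewrite (monicP (monicXnsubC _ (prime_gt0 p_pr))) scale1r.
apply/allP => _ /mapP[j _ ->]; rewrite rootE !hornerE exprMn be_p -exprM mulnC.
by rewrite exprM (prim_expr_order fz_prim) expr1n mul1r subrr.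
Qed.

(* Over a field containing [be = b^(1/p)] the matrix [A] is diagonalizable with
   the [p] distinct eigenvalues [z^j be]. *)
Lemma det_horner_radical (E : fieldType) (f : {rmorphism L -> E}) (be : E)
    n (A : 'M[L]_n) (g : {poly L}) :
  n = p -> A ^+ p = b%:M -> be ^+ p = f b ->
  f (\det (\sum_(i < size g) g`_i *: A ^+ i)) =
    \prod_(j < p) (map_poly f g).[f z ^+ j * be].
Proof.
case: n A => [|n] A np Ap be_p; first by move: p_pr; rewrite -np.
have [us sE] := radical_roots be_p; set s := map _ _ in us sE.
have -> : \sum_(i < size g) g`_i *: A ^+ i = horner_mx A g.
  rewrite -[RHS]/(horner_mx A g) -[in RHS](coefK g) poly_def rmorph_sum.
  apply: eq_bigr => i _.
  by rewrite /= linearZ rmorphXn /= horner_mx_X.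
pose Af := map_mx f A.
have Af_min : mxminpoly Af = \prod_(x <- s) ('X - x%:P).
  have Ab : mxminpoly A %= 'X^p - b%:P.
    apply: (radical_poly_irr p_pr bNp).2.
      by rewrite size_mxminpoly eqSS -lt0n mxminpoly_nonconstant.
    by apply/mxminpoly_minP; rewrite horner_mx_radical Ap subrr.
  rewrite mxminpoly_map -sE.
  have <- : map_poly f ('X^p - b%:P) = 'X^p - (f b)%:P.
    by rewrite rmorphB /= map_polyXn map_polyC.
  by congr (map_poly f _); apply/eqP; rewrite -eqp_monic ?mxminpoly_monic ?monicXnsubC ?prime_gt0.
have [P Pu /mxpoly.diagonalizable_forPex[D simD]] :
    exists2 P : 'M_n.+1, P \in unitmx & mxpoly.diagonalizable_for P Af.
  by apply/(mxpoly.diagonalizableP Af); exists s; rewrite ?Af_min ?dvdpp.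
(* The minimal polynomial sees only the set of diagonal entries; there are [p] entries and [p]
   roots, so each root occurs once. *)
have D_s : perm_eq [seq D 0 i | i <- enum 'I_n.+1] s.
  have := Af_min; rewrite (mxpoly.simmx_minpoly Pu simD) mxminpoly_diag.
  move/prod_XsubC_eq; set D' := map _ _ => D's; suff uD : uniq D' by rewrite undup_id in D's.
  by apply: negbNE; rewrite -ltn_size_undup -leqNgt (perm_size D's) /D' /s size_map size_enum_ord size_map size_enum_ord np.
have AfE : Af = invmx P *m diag_mx D *m P.
  by move/(mxpoly.simmxP Pu): simD; rewrite -mulmxA => <-; rewrite mulKmx.
rewrite -det_map_mx map_horner_mx -/Af AfE horner_mx_uconjC // horner_mx_diag.
rewrite !det_mulmx mulrAC -det_mulmx mulVmx // det1 mul1r det_diag.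
transitivity (\prod_(x <- [seq D 0 i | i <- enum 'I_n.+1]) (map_poly f g).[x]).
  by rewrite big_map big_enum; apply: eq_bigr => i _; rewrite mxE.
by rewrite (perm_big _ D_s) big_map big_enum.
Qed.

End NormDeterminant.

(** * Split symbols *)

(* The symbol algebra generated by [A], [B] with [A^p = b], [B^p = c] and
   [AB = zBA] acts on a [p]-dimensional space: [(b, c)] is trivial in the Brauer
   group.  The root of unity [z] is left unspecified, which makes the relation symmetric. *)
Definition symbol_split (p : nat) (L : fieldType) (b c : L) : Prop :=
  exists n (A B : 'M[L]_n.+1) (z : L),
    [/\ n.+1 = p, p.-primitive_root z, A ^+ p = b%:M, B ^+ p = c%:M
      & A * B = z *: (B * A)].

Lemma prim_rootV (L : fieldType) p (z : L) :
  p.-primitive_root z -> p.-primitive_root z^-1.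
Proof.
move=> z_prim; have p_gt0 := prim_order_gt0 z_prim.
have z0 : z != 0 by rewrite (prim_root_eq0 z_prim) -lt0n.
have -> : z^-1 = z ^+ p.-1.
  by apply: (mulfI z0); rewrite mulfV // -exprS prednK // prim_expr_order.
by rewrite (prim_root_exp_coprime _ z_prim) coprimePn.
Qed.

(** Exchanging [A] and [B] replaces [z] by its inverse, again primitive. *)
Lemma symbol_splitC p (L : fieldType) (b c : L) :
  symbol_split p b c -> symbol_split p c b.
Proof.
case=> n [A [B [z [np z_prim Ap Bp AB]]]]; exists n, B, A, z^-1; split=> //.
  exact: prim_rootV.
by rewrite AB scalerA mulVf ?scale1r // (prim_root_eq0 z_prim) -np.
Qed.

Lemma symbol_split_map p (L K : fieldType) (f : {rmorphism L -> K}) (b c : L) :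
  symbol_split p b c -> symbol_split p (f b) (f c).
Proof.
case=> n [A [B [z [np z_prim Ap Bp AB]]]].
exists n, (map_mx f A), (map_mx f B), (f z); split=> //.
- by rewrite fmorph_primitive_root.
- by rewrite -rmorphXn Ap /= map_scalar_mx.
- by rewrite -rmorphXn Bp /= map_scalar_mx.
- by rewrite -rmorphM AB /= map_mxZ rmorphM.
Qed.

Lemma scaled_commX (L : fieldType) n (A B : 'M[L]_n.+1) z k :
  A * B = z *: (B * A) -> A ^+ k * B = z ^+ k *: (B * A ^+ k).
Proof.
move=> AB; elim: k => [|k IHk]; first by rewrite !expr0 scale1r mul1r mulr1.
by rewrite exprSr -mulrA AB -scalerAr (mulrA (A ^+ k)) IHk -scalerAl scalerA -exprS -mulrA.
Qed.

(* [(b^i d^p, c) = (b, c)^i] and [i] is invertible mod [p]. *)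
Lemma symbol_split_expl p (L : fieldType) i (b c d : L) :
    b != 0 -> d != 0 -> (0 < i)%N -> coprime i p ->
  symbol_split p (b ^+ i * d ^+ p) c -> symbol_split p b c.
Proof.
move=> b0 d0 i_gt0 co_ip [n [A [B [z [np z_prim Ap Bp AB]]]]].
have /(coprimeP _ i_gt0)[[u v] /= uv] := co_ip.
have uvE : (u * i = (v * p).+1)%N by rewrite -[RHS]add1n -uv subnK // ltnW // -subn_gt0 uv.
(* As [u i = v p + 1], the [p]th power of [A^u] is [b (b^v d^u)^p], and [u] is prime to [p]. *)
exists n, ((b ^+ v * d ^+ u)^-1 *: A ^+ u), B, (z ^+ u); split=> //.
- rewrite (prim_root_exp_coprime _ z_prim).
  by apply/coprimeP; [case: (u) uvE | exists (i, v); rewrite mulnC].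
- have ApE : (A ^+ u) ^+ p = ((b ^+ i * d ^+ p) ^+ u)%:M.
    by rewrite -exprM mulnC exprM Ap -rmorphXn.
  rewrite exprZn ApE scale_scalar_mx; congr (_%:M).
  have -> : (b ^+ i * d ^+ p) ^+ u = b * (b ^+ v * d ^+ u) ^+ p.
    by rewrite !exprMn -!exprM (mulnC i) (mulnC p) uvE exprS mulrA.
  by rewrite exprVn mulrCA mulVf ?mulr1 // expf_neq0 // mulf_neq0 ?expf_neq0.
- rewrite -scalerAl -scalerAr (scaled_commX _ AB) !scalerA.
  by congr (_ *: _); rewrite mulrC.
Qed.

(* As [p] is odd, [(b, b) = (b, -1)] is trivial. *)
Lemma symbol_split_mulr p (L : fieldType) j (b c : L) :
  odd p -> symbol_split p b c -> symbol_split p b (c * b ^+ j).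
Proof.
move=> p_odd [n [A [B [z [np z_prim Ap Bp AB]]]]].
exists n, A, (B * A ^+ j), z; split=> //; last first.
  by rewrite mulrA AB -scalerAl -!mulrA -exprS -exprSr.
(* Sorting the factors produces the exponent [j 'C(k, 2)] of [z]; an odd [p] divides ['C(p, 2)]. *)
have BAX k : (B * A ^+ j) ^+ k = z ^+ (j * 'C(k, 2)) *: (B ^+ k * A ^+ (j * k)).
  elim: k => [|k IHk]; first by rewrite bin0n !muln0 !expr0 scale1r mulr1.
  rewrite exprSr IHk -scalerAl -mulrA [A ^+ (j * k) * _]mulrA (scaled_commX _ AB).
  rewrite -scalerAl -scalerAr scalerA -exprD binS bin1 mulnDr; congr (_ *: _).
  by rewrite !mulrA -exprSr -mulrA -exprD mulnS addnC.
rewrite BAX bin2odd // mulnCA exprM (prim_expr_order z_prim) expr1n.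
rewrite scale1r Bp mulnC exprM Ap -rmorphXn -rmorphM.
by rewrite mulrC.
Qed.

Section NormSymbol.

Variables (L : fieldType) (p : nat) (b : L).
Hypothesis p_pr : prime p.

Lemma horner_mx_twist n (A B : 'M[L]_n.+1) z h : A * B = z *: (B * A) ->
  horner_mx A h * B = B * horner_mx A (h \Po (z *: 'X)).
Proof.
move=> AB; elim/poly_ind: h => [|h c IHh].
  by rewrite comp_poly0 !rmorph0 mul0r mulr0.
rewrite comp_polyD comp_polyM comp_polyX comp_polyC !rmorphD !rmorphM /=.
rewrite linearZ /= !horner_mx_X !horner_mx_C mulrDl mulrDr -mulrA AB.
rewrite -scalerAr mulrA IHh -!scalerAr mulrA; congr (_ + _).
by rewrite -[LHS]/(_ *m _) -scalar_mxC.
Qed.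

(* A vector [v] is cyclic for [A], so [vB = v g(A)] for some [g], whence
   [vB^k = v g(A) g(zA) ... g(z^(k-1) A)]. *)
Lemma symbol_split_norm c : ~ (exists d : L, b = d ^+ p) ->
  symbol_split p b c ->
  exists2 z : L, p.-primitive_root z &
    exists g : {poly L}, 'X^p - b%:P %| twisted_norm p z g - c%:P.
Proof.
move=> bNp [n [A [B [z [np z_prim Ap Bp AB]]]]]; exists z => //.
pose v : 'rV[L]_n.+1 := delta_mx 0 ord0.
have v0 : v != 0 by apply/rV0Pn; exists ord0; rewrite mxE !eqxx oner_neq0.
pose Q : 'M[L]_n.+1 := \matrix_i (v *m A ^+ i).
have QE u : u *m Q = v *m horner_mx A (rVpoly u).
  rewrite mulmx_sum_row /rVpoly poly_def rmorph_sum /= mulmx_sumr.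
  apply: eq_bigr => i _; rewrite rowK linearZ rmorphXn /= horner_mx_X valK.
  by rewrite -scalemxAr.
(* A relation between the rows of [Q] is a polynomial of degree below [p] killing [v], but [X^p - b]
   must divide it. *)
have Qu : Q \in unitmx.
  rewrite -row_free_unit; apply: inj_row_free => u; rewrite QE.
  move/(radical_dvd_mx p_pr bNp Ap v0) => dv; apply/eqP; apply: contraTT dv => u0.
  have ru0 : rVpoly u != 0 by apply: contra_neq u0 => ru0; rewrite -[u]rVpolyK ru0 linear0.
  apply/negP => /(dvdp_leq ru0); rewrite size_radical_poly // ltnNge => /negP[].
  by rewrite -np size_poly.
pose g := rVpoly (v *m B *m invmx Q); exists g.
have vB : v *m B = v *m horner_mx A g by rewrite -QE mulmxKV.
apply: (radical_dvd_mx p_pr bNp Ap v0).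
have vBX k : v *m B ^+ k = v *m horner_mx A (twisted_norm k z g).
  elim: k => [|k IHk]; first by rewrite /twisted_norm big_ord0 rmorph1.
  rewrite exprSr -[_ * _]/(_ *m _) mulmxA IHk -mulmxA.
  rewrite -[_ *m B]/(_ * B) (horner_mx_twist _ AB) -[B * _]/(B *m _) mulmxA vB.
  by rewrite -mulmxA twisted_normS rmorphM.
by rewrite rmorphB /= horner_mx_C mulmxBr -vBX Bp subrr.
Qed.

(** On [L[X]/(X^p - b)] let [C] be multiplication by [X] and [T] the substitution of [zX] for [X].
    The powers of [T g(C)] build up the twisted norm of [g], and [T^p = 1]. *)
Lemma norm_symbol_split z g c : p.-primitive_root z ->
  'X^p - b%:P %| twisted_norm p z g - c%:P -> symbol_split p b c.
Proof.
move=> z_prim dv; have p_gt0 := prime_gt0 p_pr.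
have [n np] : exists n, n.+1 = p by exists p.-1; rewrite prednK.
pose C : 'M[L]_n.+1 := \matrix_i
  if insub i.+1 is Some j then delta_mx 0 j else b *: delta_mx 0 ord0.
pose T : 'M[L]_n.+1 := diag_mx (\row_i z ^+ i).
have CT : C * T = z *: (T * C).
  apply/row_matrixP => i; rewrite row_mul linearZ /= row_mul rowK.
  rewrite row_diag_mx -scalemxAl -rowE !rowK mxE scalerA -exprS.
  case: insubP => [j _ ji|].
    by rewrite -rowE row_diag_mx mxE ji.
  rewrite -leqNgt => iN; have -> : i.+1 = p by apply/eqP; rewrite -np eqn_leq ltn_ord.
  rewrite (prim_expr_order z_prim) scale1r -scalemxAl -rowE row_diag_mx mxE.
  by rewrite scale1r.
have CX i (iP : (i < n.+1)%N) : delta_mx 0 ord0 *m C ^+ i = delta_mx 0 (Ordinal iP) :> 'rV_n.+1.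
  elim: i iP => [|i IHi] iP; first by rewrite mulmx1; congr (delta_mx 0 _); apply: val_inj.
  rewrite exprSr mulmxA IHi ?(ltnW iP) // => iP'; rewrite -rowE rowK /=.
  by rewrite insubT.
have Cp : C ^+ p = b%:M.
  have C0 : delta_mx 0 ord0 *m C ^+ p = b *: delta_mx 0 ord0 :> 'rV_n.+1.
    rewrite -np exprSr mulmxA CX // -rowE rowK /=.
    by rewrite insubF // ltnn.
  apply/row_matrixP => i; rewrite !rowE -[i](_ : Ordinal (ltn_ord i) = i); last exact: val_inj.
  rewrite -CX -mulmxA -[C ^+ i *m C ^+ p]/(C ^+ i * C ^+ p) -exprD addnC exprD.
  by rewrite mulmxA C0 mul_mx_scalar -scalemxAl.
have Tp : T ^+ p = 1.
  suff -> k : T ^+ k = diag_mx (\row_i z ^+ (i * k)).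
    apply/matrixP => i j; rewrite !mxE mulnC exprM (prim_expr_order z_prim).
    by rewrite expr1n.
  elim: k => [|k IHk].
    by apply/matrixP => i j; rewrite !mxE muln0.
  rewrite exprSr IHk -[_ * _]/(_ *m _) mulmx_diag; congr diag_mx.
  by apply/rowP => i; rewrite !mxE -exprD mulnS addnC.
exists n, C, (T * horner_mx C g), z; split=> //.
  have BX k : (T * horner_mx C g) ^+ k = T ^+ k * horner_mx C (twisted_norm k z g).
    elim: k => [|k IHk]; first by rewrite /twisted_norm big_ord0 rmorph1 mulr1.
    rewrite exprSr IHk -mulrA [horner_mx C _ * _]mulrA (horner_mx_twist _ CT).
    rewrite twisted_normS [g * _]mulrC rmorphM.
    by rewrite !mulrA -exprSr.
  rewrite BX Tp mul1r -[twisted_norm p z g](subrK c%:P) rmorphD /= horner_mx_C.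
  have /dvdpP[q ->] := dv.
  by rewrite rmorphM /= horner_mx_radical Cp subrr mulr0 add0r.
have gC : horner_mx C g * C = C * horner_mx C g by apply: comm_horner_mx.
by rewrite mulrA CT -scalerAl -!mulrA gC.
Qed.

End NormSymbol.

(** Rigidity without extension fields: splitting is symmetric and is carried along by field
    morphisms. Exponents [j] beyond [p] only alter [d]. *)
Definition symbol_rigid (p : nat) (L : fieldType) : Prop :=
  forall b c : L, ~ (exists d, b = d ^+ p) -> c != 0 -> symbol_split p b c ->
    exists j d, d != 0 /\ c = b ^+ j * d ^+ p.

Section RadicalExtension.

Variables (p : nat) (L : fieldType) (b z : L) (E : fieldExtType L) (a : E).
Hypotheses (p_pr : prime p) (bNp : ~ exists c : L, b = c ^+ p).
Hypotheses (z_prim : p.-primitive_root z) (a_p : a ^+ p = b%:A).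
Hypothesis a_gen : <<1; a>>%VS = fullv.

Let f : {rmorphism L -> E} := in_alg E.

Lemma dim_radical_ext : \dim {:E} = p.
Proof.
have rooty : root (map_poly f ('X^p - b%:P)) a.
  by rewrite rootE rmorphB /= map_polyXn map_polyC !hornerE a_p subrr.
have /polyOver1P[q qE] := minPolyOver 1 a.
have := radical_dvd_root (f := f) p_pr bNp (h := q) a_p.
rewrite -qE => /(_ (root_minPoly _ _)) dv.
have dv' : minPoly 1 a %| map_poly f ('X^p - b%:P).
  by apply: minPoly_dvdp => //; apply/polyOver1P; exists ('X^p - b%:P).
have q_eqp : q %= 'X^p - b%:P by rewrite /eqp dv -(dvdp_map f) -qE dv'.
rewrite -a_gen dim_Fadjoin dimv1 muln1; apply/eqP.
rewrite -eqSS -size_minPoly qE size_map_poly (eqp_size q_eqp).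
by rewrite size_radical_poly.
Qed.

(** Multiplication by [a] has a matrix with [p]th power [b], and multiplication by [g(a)] is [g] of
    that matrix, so [det_horner_radical] gives its determinant. *)
Lemma fnorm_radical (g : {poly L}) :
  f (fnorm (map_poly f g).[a]) = \prod_(j < p) (map_poly f g).[f z ^+ j * a].
Proof.
have eB : basis_of {:E} (vbasis {:E}) by apply: vbasisP.
pose R (w : E) := passmx.rVof (vbasis {:E}) w.
have RZ k w : R (k *: w) = k *: R w by apply/rowP => i; rewrite !mxE linearZ.
have Rsum n (F : 'I_n -> E) : R (\sum_i F i) = \sum_i R (F i).
  by apply/rowP => i; rewrite summxE mxE linear_sum; apply: eq_bigr => j _; rewrite mxE.
pose M (x : E) := passmx.mxof (vbasis {:E}) (vbasis {:E}) (amulr x).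
have ME w x : R w *m M x = R (w * x).
  by rewrite /R -passmx.rVof_app // lfunE.
have MX w x i : R w *m M x ^+ i = R (w * x ^+ i).
  elim: i => [|i IHi]; first by rewrite !expr0 mulmx1 mulr1.
  by rewrite !exprSr mulmxA IHi ME mulrA.
have M_inj (A B : 'M[L]_(\dim {:E})) :
    (forall w, R w *m A = R w *m B) -> A = B.
  move=> AB; apply/row_matrixP => i; rewrite !rowE.
  by rewrite -[delta_mx 0 i](passmx.vecofK eB) -!/(R _).
have Mp : M a ^+ p = b%:M.
  by apply: M_inj => w; rewrite MX a_p mul_mx_scalar mulr_algr RZ.
rewrite -(@det_horner_radical _ _ _ _ p_pr bNp z_prim _ f a _ (M a) g dim_radical_ext) //.
congr (f (\det _)); apply: M_inj => w.
rewrite ME mulmx_sumr horner_coef size_map_poly mulr_sumr Rsum.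
apply: eq_bigr => i _; rewrite coef_map -scalemxAr MX -RZ /=.
by rewrite mulr_algl scalerAr.
Qed.

End RadicalExtension.

Lemma p_rigid_symbol_rigid p (L : fieldType) :
  prime p -> p_rigid p L -> symbol_rigid p L.
Proof.
move=> p_pr rigL b c bNp c0 /(symbol_split_norm p_pr bNp)[z z_prim [g dv]].
have [E _ [a]] := irredp_FAdjoin (radical_poly_irr p_pr bNp).
rewrite rootE rmorphB /= map_polyXn map_polyC !hornerE subr_eq0 => /eqP a_p a_gen.
have [_ _ /(_ E a a_p a_gen)] := rigL b (radicand_neq0 p_pr bNp) bNp.
pose f : {rmorphism L -> E} := in_alg E.
move/(_ (map_poly f g).[a]); have fnormE : fnorm (map_poly f g).[a] = c.
  apply: (fmorph_inj f); rewrite (fnorm_radical p_pr bNp z_prim a_p a_gen).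
  rewrite -horner_twisted_norm; apply/eqP; rewrite -subr_eq0.
  have /dvdpP[q qE] := dv; rewrite -[twisted_norm p z g](subrK c%:P) qE.
  rewrite rmorphD rmorphM rmorphB /= map_polyXn !map_polyC !hornerE a_p.
  by rewrite subrr mulr0 add0r subrr.
rewrite fnormE; case.
  have := c0; rewrite -(fmorph_eq0 f) -fnormE (fnorm_radical p_pr bNp z_prim a_p a_gen).
  by move/prodf_neq0/(_ (Ordinal (prime_gt0 p_pr)) isT); rewrite expr0 mul1r.
by move=> j _ [d d0 ->]; exists j, d.
Qed.

Lemma symbol_rigid_p_rigid p (L : fieldType) (z : L) :
  prime p -> p.-primitive_root z -> symbol_rigid p L -> p_rigid p L.
Proof.
move=> p_pr z_prim rigL b b0 bNp; split=> // E a a_p a_gen x x0.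
have [j [d [d0 cE]]] : exists j d, d != 0 /\ fnorm x = b ^+ j * d ^+ p.
  pose f : {rmorphism L -> E} := in_alg E.
  have [g xE] : exists g, x = (map_poly f g).[a].
    have /Fadjoin_polyP[g' /polyOver1P[g ->] ->] : x \in <<1; a>>%VS by rewrite a_gen memvf.
    by exists g.
  have fx := fnorm_radical p_pr bNp z_prim a_p a_gen g; rewrite -xE in fx.
  apply: rigL => //; last first.
    apply: (norm_symbol_split p_pr z_prim (g := g)).
    apply: (radical_dvd_root (f := f) p_pr bNp a_p).
    by rewrite rootE rmorphB hornerD hornerN horner_twisted_norm -fx /= map_polyC hornerC subrr.
  (* If a conjugate [g(z^i a)] vanished, [X^p - b] would divide [g], and [x = g(a)] would be 0. *)
  rewrite -(fmorph_eq0 f) fx; apply/prodf_neq0 => i _; apply: contra_neq x0 => gi; rewrite xE.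
  have /dvdpP[q ->] : 'X^p - b%:P %| g.
    apply: (radical_dvd_root (f := f) (be := f z ^+ i * a) p_pr bNp); last exact/rootP.
    by rewrite exprMn a_p -!rmorphXn -exprM mulnC exprM (prim_expr_order z_prim) expr1n rmorph1 mul1r.
  by rewrite rmorphM rmorphB /= map_polyXn map_polyC !hornerE a_p subrr mulr0.
exists (j %% p)%N; first by rewrite ltn_mod prime_gt0.
exists (b ^+ (j %/ p) * d); first by rewrite mulf_neq0 ?expf_neq0.
by rewrite cE {1}(divn_eq j p) exprD exprMn -exprM mulrA [b ^+ (_ * _) * _]mulrC.
Qed.

(** * Multiplicative group modulo pth powers as a module *)

Lemma modn_eq_mod p q n : q = p -> n = n %% q %[mod p].
Proof. by move=> ->; rewrite modn_mod. Qed.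

Definition pth_equiv (p : nat) (K : fieldType) (x y : K) : Prop :=
  exists2 k : K, k != 0 & x = y * k ^+ p.

Section PthEquiv.

Variables (p : nat) (K : fieldType).
Local Notation "x ~ y" := (@pth_equiv p K x y) (at level 70).
Implicit Types x y : K.

Lemma pth_equiv_refl x : x ~ x.
Proof. by exists 1; rewrite ?oner_neq0 // expr1n mulr1. Qed.

Lemma pth_equiv_sym x y : x ~ y -> y ~ x.
Proof.
case=> k k0 ->; exists k^-1; first by rewrite invr_eq0.
by rewrite exprVn mulfK // expf_neq0.
Qed.

Lemma pth_equiv_trans y x x' : x ~ y -> y ~ x' -> x ~ x'.
Proof.
case=> k k0 -> [l l0 ->]; exists (l * k); first by rewrite mulf_neq0.
by rewrite exprMn mulrA.
Qed.

Lemma pth_equivM x y x' y' : x ~ y -> x' ~ y' -> x * x' ~ y * y'.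
Proof.
case=> k k0 -> [l l0 ->]; exists (k * l); first by rewrite mulf_neq0.
by rewrite exprMn mulrACA.
Qed.

Lemma pth_equivX n x y : x ~ y -> x ^+ n ~ y ^+ n.
Proof.
case=> k k0 ->; exists (k ^+ n); first by rewrite expf_neq0.
by rewrite exprMn -!exprM (mulnC p).
Qed.

Lemma pth_equiv_map (s : {rmorphism K -> K}) x y : x ~ y -> s x ~ s y.
Proof. by case=> k k0 ->; exists (s k); rewrite ?fmorph_eq0 // rmorphM rmorphXn. Qed.

Lemma pth_equiv_prod I (r : seq I) (F G : I -> K) :
  (forall i, F i ~ G i) -> \prod_(i <- r) F i ~ \prod_(i <- r) G i.
Proof.
move=> FG; elim/big_rec2: _ => [|i x y _ xy]; first exact: pth_equiv_refl.
exact: pth_equivM.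
Qed.

Lemma pth_equiv_expr_mod x m n : x != 0 -> m = n %[mod p] -> x ^+ m ~ x ^+ n.
Proof.
move=> x0 mn; apply: (@pth_equiv_trans (x ^+ (m %% p))); last apply: pth_equiv_sym; rewrite ?mn.
  exists (x ^+ (m %/ p)); first by rewrite expf_neq0.
  by rewrite -exprM -exprD addnC -mn -divn_eq.
exists (x ^+ (n %/ p)); first by rewrite expf_neq0.
by rewrite -exprM -exprD addnC -divn_eq.
Qed.

End PthEquiv.

Section GroupRingAction.

Variables (p : nat) (K : fieldType) (s : {rmorphism K -> K}).
Hypothesis p_pr : prime p.
Local Notation "x ~ y" := (@pth_equiv p K x y) (at level 70).
Implicit Types (x y : K) (g h : {poly 'F_p}).

(* The action of [F_p[X]] on [K^*] modulo [p]th powers through [X |-> s],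
   written with the representatives of the coefficients in [0, p). *)
Definition pact h x : K := \prod_(i < size h) iter i s x ^+ (h`_i)%R.

Lemma pact_wide n h x : (size h <= n)%N ->
  pact h x = \prod_(i < n) iter i s x ^+ (h`_i)%R.
Proof.
move=> hn; rewrite /pact (big_ord_widen n (fun i => iter i s x ^+ (h`_i)%R)) //.
rewrite big_mkcond; apply: eq_bigr => i _; case: ltnP => // hi.
by rewrite nth_default // expr0.
Qed.

Lemma val_Fp_addn (a b : 'F_p) : (a + b)%N = (a + b)%R %[mod p].
Proof. exact: modn_eq_mod (Fp_cast p_pr). Qed.

Lemma val_Fp_muln (a b : 'F_p) : (a * b)%N = (a * b)%R %[mod p].
Proof. exact: modn_eq_mod (Fp_cast p_pr). Qed.

Lemma iter_rmorph_neq0 i x : x != 0 -> iter i s x != 0.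
Proof. by move=> x0; elim: i => //= i IHi; rewrite fmorph_eq0. Qed.

Lemma pact_neq0 h x : x != 0 -> pact h x != 0.
Proof. by move=> x0; apply/prodf_neq0 => i _; rewrite expf_neq0 ?iter_rmorph_neq0. Qed.

Lemma pact_equiv h x y : x ~ y -> pact h x ~ pact h y.
Proof.
move=> xy; apply: pth_equiv_prod => i; apply: pth_equivX.
by elim: (i : nat) => //= k; apply: pth_equiv_map.
Qed.

Lemma pactD g h x : x != 0 -> pact (g + h) x ~ pact g x * pact h x.
Proof.
move=> x0; pose n := maxn (size g) (size h).
rewrite !(@pact_wide n) ?size_polyD ?leq_maxl ?leq_maxr // -big_split.
apply: pth_equiv_prod => i /=; rewrite -exprD coefD.
by apply: pth_equiv_expr_mod; rewrite ?iter_rmorph_neq0 // val_Fp_addn.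
Qed.

Lemma pactZ (c : 'F_p) h x : x != 0 -> pact (c *: h) x ~ pact h x ^+ c.
Proof.
move=> x0; rewrite (pact_wide x (size_scale_leq c h)) /pact -prodrXl.
apply: pth_equiv_prod => i /=; rewrite -exprM coefZ mulnC.
by apply: pth_equiv_expr_mod; rewrite ?iter_rmorph_neq0 // val_Fp_muln.
Qed.

Lemma pactMX h x : pact (h * 'X) x = s (pact h x).
Proof.
have szh : (size (h * 'X)%R <= (size h).+1)%N.
  by rewrite (leq_trans (size_polyMleq _ _)) // size_polyX addn2.
rewrite (pact_wide x szh) big_ord_recl coefMX eqxx expr0 mul1r rmorph_prod.
by apply: eq_bigr => i _; rewrite coefMX /= rmorphXn.
Qed.

Lemma pactC (c : 'F_p) x : pact c%:P x = x ^+ c.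
Proof. by rewrite (@pact_wide 1) ?size_polyC ?leq_b1 // big_ord1 coefC. Qed.

(** With [pactD] this makes [K^*/K^p] an [F_p[X]]-module; equality holds only up to [p]th powers,
    because the exponents are reduced modulo [p]. *)
Lemma pactM g h x : x != 0 -> pact (g * h) x ~ pact g (pact h x).
Proof.
move=> x0; elim/poly_ind: g => [|g c IHg].
  by rewrite mul0r /pact size_poly0 !big_ord0; apply: pth_equiv_refl.
have h0 := pact_neq0 h x0.
rewrite mulrDl mulrAC mul_polyC; apply: (pth_equiv_trans (pactD _ _ x0)).
apply: (pth_equiv_trans _ (pth_equiv_sym (pactD _ _ h0))).
rewrite !pactMX pactC; apply: pth_equivM; last exact: pactZ.
exact: pth_equiv_map.
Qed.

Lemma pact_fixed h x : x != 0 -> s x = x -> pact h x ~ x ^+ h.[1].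
Proof.
move=> x0 sx; elim/poly_ind: h => [|h c IHh].
  by rewrite /pact size_poly0 big_ord0 horner0; apply: pth_equiv_refl.
apply: (pth_equiv_trans (pactD _ _ x0)); rewrite pactMX pactC.
apply: (@pth_equiv_trans _ _ (x ^+ h.[1] * x ^+ c)).
  apply: pth_equivM; last exact: pth_equiv_refl.
  by apply: (pth_equiv_trans (pth_equiv_map s IHh)); rewrite rmorphXn /= sx; apply: pth_equiv_refl.
by rewrite -exprD !hornerE; apply: pth_equiv_expr_mod => //; rewrite val_Fp_addn.
Qed.

(** The trace element of the group ring; in multiplicative notation it acts as the norm. *)
Definition trace_poly : {poly 'F_p} := \poly_(i < p) 1.

Lemma pact_trace x : pact trace_poly x = \prod_(i < p) iter i s x.
Proof.
rewrite (pact_wide x (size_poly _ _)); apply: eq_bigr => i _.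
by rewrite coef_poly ltn_ord expr1.
Qed.

(** By Frobenius [(X - 1)^p = X^p - 1], and one factor [X - 1] cancels. *)
Lemma trace_polyE : trace_poly = ('X - 1%:P) ^+ p.-1.
Proof.
have X1 : 'X - 1%:P != 0 :> {poly 'F_p} by rewrite polyXsubC_eq0.
apply: (mulfI X1); rewrite -exprS prednK ?prime_gt0 //.
have pchF : p \in [pchar {poly 'F_p}] by rewrite pchar_poly pchar_Fp.
have := pFrobenius_autB_comm pchF (commr1 'X); rewrite !pFrobenius_autE expr1n => ->.
rewrite subrX1 /trace_poly poly_def; congr (_ * _).
by apply: eq_bigr => i _; rewrite scale1r.
Qed.

Section Periodic.

Variable y : K.
Hypotheses (y0 : y != 0) (y_per : iter p s y = y).

Lemma norm_fixed : s (\prod_(i < p) iter i s y) = \prod_(i < p) iter i s y.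
Proof.
rewrite rmorph_prod -(prednK (prime_gt0 p_pr)).
rewrite big_ord_recr [RHS]big_ord_recl [LHS]mulrC /= -iterS prednK ?prime_gt0 //.
by rewrite y_per.
Qed.

(** The trace element sends [y] to its norm; this is fixed by [s], so [X] acts on it as 1. *)
Lemma pact_mul_trace h :
  pact (h * trace_poly) y ~ (\prod_(i < p) iter i s y) ^+ h.[1].
Proof.
apply: (pth_equiv_trans (pactM _ _ y0)); rewrite pact_trace.
by apply: pact_fixed norm_fixed; rewrite -pact_trace pact_neq0.
Qed.

(* The annihilator of [y] in [F_p[X]/(X - 1)^p] is an ideal, hence, if nonzero,
   contains [(X - 1)^(p-1)]. *)
Lemma pact_free h : h != 0 -> (size h <= p)%N -> pact h y ~ 1 ->
  \prod_(i < p) iter i s y ~ 1.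
Proof.
move=> h0 szh h1; have [m [q]] := multiplicity_XsubC h 1.
rewrite h0 /= => q1 hE; have q0 : q != 0 by apply: contraNneq h0 => q0; rewrite hE q0 mul0r.
have mp : (m <= p.-1)%N.
  have szq : (0 < size q)%N by rewrite size_poly_gt0.
  have qm : (size q + m <= p)%N.
    by move: szh; rewrite hE size_Mmonic ?monic_exp ?monicXsubC // size_exp_XsubC addnS.
  rewrite -ltnS prednK ?prime_gt0 //; apply: leq_trans qm.
  by rewrite -add1n leq_add2r.
(* Completing the factor [(X - 1)^m] of [h] to [(X - 1)^(p-1)] gives [q] times the trace element,
   which acts as [N^(q(1))] with [q(1)] prime to [p]. *)
have : pact (('X - 1%:P) ^+ (p.-1 - m) * h) y ~ 1.
  apply: (pth_equiv_trans (pactM _ _ y0)); apply: (pth_equiv_trans (pact_equiv _ h1)).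
  rewrite /pact big1 => [|i _]; first exact: pth_equiv_refl.
  by rewrite (_ : iter i s 1 = 1) ?expr1n //; elim: (i : nat) => //= k ->; rewrite rmorph1.
rewrite hE mulrCA -exprD subnK // -trace_polyE => qS.
have := pth_equiv_trans (pth_equiv_sym (pact_mul_trace q)) qS.
set N := \prod_(i < p) _; case=> k k0; rewrite mul1r => Nk.
have [] := root_of_coprime_exp _ _ Nk.
- by rewrite lt0n; apply: contraNneq q1 => q1; apply/rootP/val_inj.
- rewrite coprime_sym prime_coprime // gtnNdvd //.
    by rewrite lt0n; apply: contraNneq q1 => q1; apply/rootP/val_inj.
  by rewrite -[X in (_ < X)%N](Fp_cast p_pr) ltn_ord.
move=> l Nl; exists l; last by rewrite mul1r.
have : N != 0 by rewrite /N -pact_trace pact_neq0.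
by rewrite Nl expf_eq0 prime_gt0.
Qed.

End Periodic.

End GroupRingAction.

(** * Norms in rigid fields *)

Lemma twisted_norm_Xsub1 (L : fieldType) p (z : L) :
  odd p -> p.-primitive_root z -> twisted_norm p z ('X - 1%:P) = 'X^p - 1.
Proof.
move=> p_odd z_prim; have p_gt0 := prim_order_gt0 z_prim.
have z0 : z != 0 by rewrite (prim_root_eq0 z_prim) -lt0n.
transitivity (\prod_(j < p) (z ^+ j *: ('X - (z^-1 ^+ j)%:P))).
  apply: eq_bigr => j _; rewrite comp_polyB comp_polyX comp_polyC scalerBr.
  by congr (_ - _); rewrite -mul_polyC -polyCM exprVn mulfV ?expf_neq0.
rewrite scaler_prod -(factor_Xn_sub_1 (prim_rootV z_prim)) big_mkord.
(* The product is [z^'C(p, 2)], and [p] is odd. *)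
have -> : \prod_(j < p) z ^+ j = 1; last by rewrite scale1r.
rewrite -expr_sum -(big_mkord xpredT id) bin2_sum bin2odd //.
by rewrite exprM (prim_expr_order z_prim) expr1n.
Qed.

Lemma oppr_pth (K : fieldType) p (k : K) : odd p -> - (k ^+ p) = (- k) ^+ p.
Proof. by move=> p_odd; rewrite exprNn -signr_odd p_odd mulN1r. Qed.

Section RigidField.

Variables (p : nat) (K : fieldType) (z : K).
Hypotheses (p_pr : prime p) (p_odd : odd p) (z_prim : p.-primitive_root z).
Hypothesis K_rigid : symbol_rigid p K.
Local Notation "x ~ y" := (@pth_equiv p K x y) (at level 70).

(* [- (1 + x)] is the norm of [a - 1], where [a^p = - x]. *)
Lemma rigid_add1 (x : K) : ~ (exists k, x = k ^+ p) -> 1 + x != 0 ->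
  exists j, 1 + x ~ x ^+ j.
Proof.
move=> xNp x1; have oppNp : ~ exists k, - x = k ^+ p.
  by case=> k xk; apply: xNp; exists (- k); rewrite -oppr_pth // -xk opprK.
have split1 : symbol_split p (- x) (- (1 + x)).
  apply: (norm_symbol_split p_pr z_prim (g := 'X - 1%:P)).
  by rewrite twisted_norm_Xsub1 // !polyCN polyCD !opprK addrA subrK.
have [|j [d [d0 xE]]] := K_rigid oppNp _ split1; first by rewrite oppr_eq0.
exists j; exists (- ((-1) ^+ j * d)); first by rewrite oppr_eq0 mulf_neq0 ?signr_eq0.
rewrite -oppr_pth // mulrN exprMn -exprM mulnC exprM -signr_odd p_odd expr1.
by rewrite mulrA -exprMn mulrN1 -xE opprK.
Qed.

Variables (s : {rmorphism K -> K}) (y : K).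
Hypothesis y_per : iter p s y = y.

(* If the norm of [y] is not a [p]th power, then the conjugates of [y] are
   independent modulo [p]th powers; by rigidity their sum, the trace [t], lies
   in their affine span modulo [p]th powers.  Hence the norms of [t] and [y]
   agree modulo [p]th powers, while the norm of [t] is [t^p]. *)
Lemma rigid_norm_pth : exists k, \prod_(i < p) iter i s y = k ^+ p.
Proof.
set N := \prod_(i < p) _.
have [y0|y0] := eqVneq y 0.
  exists 0; rewrite /N (bigD1 (Ordinal (prime_gt0 p_pr))) //= y0 mul0r expr0n.
  by rewrite gtn_eqF ?prime_gt0.
have [//|NNp] := classic (exists k, N = k ^+ p).
have N1 : ~ N ~ 1 by case=> k _; rewrite mul1r => Nk; apply: NNp; exists k.
pose t k : K := \sum_(i < k) iter i s y.
(* Conjugates are added one at a time: the size bound keeps the next one independent of [t k], and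
   [u.[1] = 1] says that the exponents sum to 1. *)
have t_span k : (0 < k <= p)%N ->
    t k != 0 /\ exists u : {poly 'F_p}, [/\ (size u <= k)%N, u.[1] = 1 & t k ~ pact s u y].
  elim: k => // -[_ _|k IHk /andP[_ kp]].
    rewrite /t big_ord1; split=> //; exists 1; rewrite size_poly1 hornerC.
    by split=> //; rewrite pactC expr1; apply: pth_equiv_refl.
  have [tk0 [u [szu u1 tu]]] := IHk (ltnW kp).
  set w := iter k.+1 s y.
  have w0 : w != 0 by apply: iter_rmorph_neq0.
  have tE : t k.+2 = t k.+1 * (1 + w / t k.+1).
    by rewrite mulrDr mulr1 mulrC divfK // /t big_ord_recr.
  (* [h] acts as [w / t k.+1]; it is nonzero of size at most [p], so by [pact_free] this quotient is
     not a [p]th power. *)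
  pose h : {poly 'F_p} := 'X^(k.+1) - u.
  have szh : size h = k.+2.
    by rewrite /h size_polyDl ?size_polyXn // size_polyN ltnS.
  have wX : pact s ('X^(k.+1) : {poly 'F_p}) y = w.
    rewrite (@pact_wide p _ s k.+2) ?size_polyXn // big_ord_recr /=.
    rewrite coefXn eqxx expr1 big1 ?mul1r // => i _.
    by rewrite coefXn ltn_eqF.
  have hw : pact s h y ~ w / t k.+1.
    have := pactD s p_pr h u y0; rewrite subrK wX => whu.
    apply: (@pth_equiv_trans _ _ (pact s h y * pact s u y / t k.+1)); last first.
      by apply: pth_equivM; [apply: pth_equiv_sym | apply: pth_equiv_refl].
    rewrite -mulrA -{1}[pact s h y]mulr1; apply: pth_equivM; first exact: pth_equiv_refl.
    by have := pth_equivM tu (pth_equiv_refl p (t k.+1)^-1); rewrite mulfV.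
  have h0 : h != 0 by rewrite -size_poly_eq0 szh.
  have wNp : ~ exists l, w / t k.+1 = l ^+ p.
    case=> l wl; apply: N1; apply: (pact_free p_pr y0 y_per h0); first by rewrite szh.
    apply: (pth_equiv_trans hw); exists l; last by rewrite mul1r.
    by apply: contra_neq w0 => l0; move: wl; rewrite l0 expr0n gtn_eqF ?prime_gt0 // => /eqP; rewrite mulf_eq0 invr_eq0 (negPf tk0) orbF => /eqP.
  have w1 : 1 + w / t k.+1 != 0.
    apply/eqP => w1; apply: wNp; exists (-1).
    by rewrite -oppr_pth // expr1n; apply/eqP; rewrite -subr_eq0 opprK addrC w1.
  split; first by rewrite tE mulf_neq0.
  have [j wj] := rigid_add1 wNp w1.
  (* Rigidity multiplies [t k.+1] by [(w / t k.+1)^j]; as [h.[1] = 0], the exponents still sum to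
     1. *)
  exists (u + j%:R *: h); split.
  - apply: leq_trans (size_polyD _ _) _; rewrite geq_max (leq_trans szu) //=.
    by rewrite (leq_trans (size_scale_leq _ _)) ?szh.
  - by rewrite hornerD hornerZ hornerD hornerN hornerXn u1 expr1n subrr mulr0 addr0.
  apply: pth_equiv_sym; apply: (pth_equiv_trans (pactD s p_pr _ _ y0)).
  rewrite tE; apply: pth_equivM; first exact: pth_equiv_sym.
  apply: (pth_equiv_trans (pactZ s p_pr _ _ y0)).
  apply: (pth_equiv_trans (pth_equivX _ hw)); apply: pth_equiv_sym.
  apply: (pth_equiv_trans wj); apply: pth_equiv_expr_mod.
    by rewrite mulf_neq0 ?invr_eq0.
  by rewrite val_Fp_nat // modn_mod.
have [] := t_span p; first by rewrite prime_gt0 /=.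
set T := t p => T0 [u [_ u1 Tu]]; case: N1.
have sT : s T = T.
  rewrite /T /t rmorph_sum -(prednK (prime_gt0 p_pr)).
  rewrite big_ord_recr [RHS]big_ord_recl [LHS]addrC /= -iterS prednK ?prime_gt0 //.
  by rewrite y_per.
have NT : pact s (trace_poly p) T ~ 1.
  rewrite pact_trace (eq_bigr (fun=> T)) => [|i _]; last by elim: (i : nat) => //= k ->.
  by rewrite prodr_const card_ord; exists T; rewrite ?mul1r.
have := pact_mul_trace p_pr y0 y_per u; rewrite u1 expr1 mulrC => NuT.
apply: (pth_equiv_trans (pth_equiv_sym NuT)).
apply: (pth_equiv_trans (pactM s p_pr _ _ y0)).
by apply: (pth_equiv_trans _ NT); apply/pact_equiv/pth_equiv_sym.
Qed.

End RigidField.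

(** * Descent along a cyclic extension *)

(** Both products run over the [p] roots of [X^p - f a], in different orders. This reconciles the
    unspecified root of a split symbol with the one given by [s]. *)
Lemma horner_twisted_norm_indep (p : nat) (L : fieldType) (a z w : L) (g : {poly L})
    (E : fieldType) (f : {rmorphism L -> E}) (al : E) :
    prime p -> ~ (exists c, a = c ^+ p) -> p.-primitive_root z -> p.-primitive_root w ->
    al ^+ p = f a ->
  (map_poly f (twisted_norm p z g)).[al] = (map_poly f (twisted_norm p w g)).[al].
Proof.
move=> p_pr aNp z_prim w_prim al_p; rewrite !horner_twisted_norm.
have [_ zE] := radical_roots p_pr aNp z_prim al_p.
have [_ wE] := radical_roots p_pr aNp w_prim al_p.
have eq_prod := perm_big (op := *%R) _ (prod_XsubC_eq (etrans (esym zE) wE)).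
have := eq_prod E 1 xpredT (fun x => (map_poly f g).[x]).
by rewrite big_map big_enum big_map big_enum.
Qed.

(** The resolvents [r i] are eigenvectors for [z^i] with sum [p k]. If all with [0 < i < p]
    vanished, [p k = r 0] would be fixed, and so would [k], as [p] is nonzero in [K]. *)
Lemma lagrange_resolvent (p : nat) (K : fieldType) (s : {rmorphism K -> K}) (z k : K) :
    prime p -> p.-primitive_root z -> s z = z -> iter p s k = k -> s k != k ->
  exists i al, [/\ coprime i p, al != 0 & s al = z ^+ i * al].
Proof.
move=> p_pr z_prim sz k_per k_moved; have p_gt0 := prime_gt0 p_pr.
have z0 : z != 0 by rewrite (prim_root_eq0 z_prim) -lt0n.
have zV := prim_rootV z_prim; set w := z^-1 in zV.
pose r i := \sum_(j < p) w ^+ (i * j) * iter j s k.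
have sr i : s (r i) = z ^+ i * r i.
  have wz : w ^+ i * z ^+ i = 1 by rewrite -exprMn mulVf // expr1n.
  apply: (@mulfI _ (w ^+ i)); first by rewrite expf_neq0 ?invr_eq0.
  rewrite mulrA wz mul1r /r rmorph_sum mulr_sumr -(prednK p_gt0).
  rewrite big_ord_recr [RHS]big_ord_recl [LHS]addrC /=; congr (_ + _).
    rewrite rmorphM rmorphXn fmorphV sz -/w -iterS prednK // k_per mulrA -exprD.
    by rewrite -mulnS prednK // mulnC exprM (prim_expr_order zV) expr1n muln0 expr0.
  apply: eq_bigr => j _.
  by rewrite rmorphM rmorphXn fmorphV sz -/w mulrA -exprD -mulnS.
have rsum : \sum_(i < p) r i = p%:R * k.
  rewrite exchange_big (bigD1 (Ordinal p_gt0)) //= [X in _ + X]big1 ?addr0.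
    rewrite (eq_bigr (fun=> k)) => [|i _]; last by rewrite muln0 expr0 mul1r.
    by rewrite sumr_const card_ord mulr_natl.
  move=> j j0; rewrite -mulr_suml; apply/eqP; rewrite mulf_eq0; apply/orP; left.
  have wj : w ^+ j - 1 != 0.
    rewrite subr_eq0 -(prim_order_dvd zV) gtnNdvd // lt0n.
    by apply: contraNneq j0 => j0; apply/eqP/val_inj.
  rewrite -(inj_eq (mulfI wj)) mulr0; apply/eqP.
  rewrite (eq_bigr (fun i : 'I_p => (w ^+ j) ^+ i)) => [|i _]; last by rewrite mulnC exprM.
  by rewrite -subrX1 -exprM mulnC exprM (prim_expr_order zV) expr1n subrr.
have [/existsP[i /andP[i0 ri]]|] := boolP [exists i : 'I_p, (0 < i)%N && (r i != 0)].
  exists i, (r i); split=> //.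
  by rewrite coprime_sym prime_coprime // gtnNdvd.
rewrite negb_exists => /forallP r0; case/negP: k_moved.
have rE : p%:R * k = r 0%N.
  rewrite -rsum (bigD1 (Ordinal p_gt0)) //= big1 ?addr0 // => i i0.
  apply/eqP; have := r0 i; rewrite negb_and negbK => /orP[|//].
  by rewrite -eqn0Ngt => /eqP i00; case/eqP: i0; apply: val_inj.
have pn0 := prim_root_natf_neq0 z_prim.
by apply/eqP/(mulfI pn0); rewrite rE -[p%:R](rmorph_nat s) -rmorphM rE sr mul1r.
Qed.

Section Descent.

Variables (p : nat) (F K : fieldType) (f : {rmorphism F -> K}) (s : {rmorphism K -> K}).
Variable z : F.
Hypotheses (p_pr : prime p) (p_odd : odd p) (z_prim : p.-primitive_root z).
Hypotheses (s_f : forall x, s (f x) = f x) (s_fix : forall k, s k = k -> exists x, k = f x).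
Hypothesis s_per : forall k, iter p s k = k.

Section Kummer.

Variables (w a : F) (al : K).
Hypotheses (w_prim : p.-primitive_root w) (al0 : al != 0).
Hypotheses (s_al : s al = f w * al) (al_p : al ^+ p = f a).

(** [s k / k] is a [p]th root of unity [w^i], so [k / al^i] is fixed by [s] and comes from [F]. *)
Lemma kummer_radicand k d : k != 0 -> k ^+ p = f d ->
  exists i m, m != 0 /\ d = a ^+ i * m ^+ p.
Proof.
move=> k0 kd; have fw_prim : p.-primitive_root (f w) by rewrite fmorph_primitive_root.
have [|i sk] := prim_rootP fw_prim (x := s k / k).
  by rewrite expr_div_n -rmorphXn kd s_f divff // -kd expf_neq0.
have skE : s k = f w ^+ i * k by rewrite -sk divfK.
have [|m mE] := s_fix (k := k / al ^+ i).
  rewrite fmorph_div rmorphXn s_al skE exprMn -mulf_div divff ?mul1r //.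
  by rewrite expf_neq0 // fmorph_eq0 (prim_root_eq0 w_prim) -lt0n prime_gt0.
exists i, m; split.
  by rewrite -(fmorph_eq0 f) -mE mulf_neq0 ?invr_eq0 ?expf_neq0.
apply: (fmorph_inj f); rewrite rmorphM !rmorphXn -al_p -mE -kd expr_div_n.
by rewrite -!exprM (mulnC p) mulrC divfK // expf_neq0.
Qed.

(** Otherwise [al] would differ from an element of [F] by a power of [z] and be fixed by [s],
    although [w] is not 1. *)
Lemma radicand_Npth : ~ exists c, a = c ^+ p.
Proof.
case=> l al_l; have fw1 : f w != 1.
  rewrite -(rmorph1 f) fmorph_eq; apply: contraTneq w_prim => ->.
  by apply/negP => /prim_order_dvd/(_ 1%N); rewrite expr1n eqxx dvdn1 gtn_eqF ?prime_gt1.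
have fl0 : f l != 0.
  apply: contra_neq al0 => fl0; apply/eqP; move: al_p; rewrite al_l rmorphXn fl0.
  by rewrite expr0n gtn_eqF ?prime_gt0 // => /eqP; rewrite expf_eq0 prime_gt0.
have fz_prim : p.-primitive_root (f z) by rewrite fmorph_primitive_root.
have [|i alE] := prim_rootP fz_prim (x := al / f l).
  by rewrite expr_div_n al_p al_l rmorphXn divff ?expf_neq0.
have : s al = al by rewrite -[al](divfK fl0) alE -rmorphXn -rmorphM s_f.
by rewrite s_al -[RHS]mul1r => /(mulIf al0)/eqP; rewrite (negPf fw1).
Qed.

Hypothesis K_rigid : symbol_rigid p K.

(** [c] is the product of the [g(w^i al)], the conjugates of [g(al)] under [s], so [rigid_norm_pth]
    applies. *)
Lemma symbol_split_pth c : symbol_split p a c -> exists k, f c = k ^+ p.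
Proof.
case/(symbol_split_norm p_pr radicand_Npth) => z' z'_prim [g dv].
have fz_prim : p.-primitive_root (f z) by rewrite fmorph_primitive_root.
have [k kE] := rigid_norm_pth p_pr p_odd fz_prim K_rigid (s_per (map_poly f g).[al]).
exists k; rewrite -kE.
have -> : \prod_(i < p) iter i s (map_poly f g).[al] =
    (map_poly f (twisted_norm p w g)).[al].
  rewrite horner_twisted_norm; apply: eq_bigr => i _.
  elim: (i : nat) => [|j /= ->]; first by rewrite expr0 mul1r.
  rewrite -horner_map /= rmorphM rmorphXn s_f s_al mulrA -exprSr; congr (_.[_]).
  by apply/polyP => l; rewrite !coef_map /= s_f.
rewrite -(horner_twisted_norm_indep _ p_pr radicand_Npth z'_prim w_prim al_p).
have /dvdpP[q qE] := dv; apply: esym.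
rewrite -[twisted_norm p z' g](subrK c%:P) qE.
rewrite rmorphD rmorphM rmorphB /= map_polyXn !map_polyC !hornerE al_p.
by rewrite subrr mulr0 add0r.
Qed.

End Kummer.

Hypothesis K_rigid : symbol_rigid p K.

Lemma rigid_descent : symbol_rigid p F.
Proof.
move=> b c bNp c0 bc; have b0 := radicand_neq0 p_pr bNp.
have fbc : symbol_split p (f b) (f c) by apply: symbol_split_map.
(* If [s] is trivial, [f] is onto and rigidity transfers directly. *)
have [fix_all|] := classic (forall k, s k = k).
  have fbNp : ~ exists k, f b = k ^+ p.
    case=> k; have [l ->] := s_fix (fix_all k); rewrite -rmorphXn => /fmorph_inj bl.
    by apply: bNp; exists l.
  have [|j [d]] := K_rigid fbNp _ fbc; first by rewrite fmorph_eq0.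
  have [l ->] := s_fix (fix_all d); rewrite -!rmorphXn -rmorphM fmorph_eq0.
  by case=> l0 /fmorph_inj cE; exists j, l.
case/not_all_ex_not => k0 /eqP k0_moved.
have fz_prim : p.-primitive_root (f z) by rewrite fmorph_primitive_root.
have [i [al [i_co al0 s_al]]] := lagrange_resolvent p_pr fz_prim (s_f z) (s_per k0) k0_moved.
have w_prim : p.-primitive_root (z ^+ i) by rewrite prim_root_exp_coprime.
rewrite -rmorphXn in s_al.
have [|a al_p] := s_fix (k := al ^+ p).
  by rewrite rmorphXn s_al exprMn -rmorphXn (prim_expr_order w_prim) rmorph1 mul1r.
have kummer := kummer_radicand w_prim al0 s_al al_p.
have split_pth := symbol_split_pth w_prim al0 s_al al_p K_rigid.
have a0 : a != 0 by rewrite -(fmorph_eq0 f) -al_p expf_neq0.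
have coprime_gt0 l : ~~ (p %| l)%N -> (0 < l)%N && coprime l p.
  move=> p_l; rewrite coprime_sym prime_coprime // p_l andbT lt0n.
  by apply: contraNneq p_l => ->; rewrite dvdn0.
have [[k fbk]|fbNp] := classic (exists k, f b = k ^+ p).
  have k_neq0 : k != 0.
    by apply: contra_neq b0 => k00; apply/eqP; rewrite -(fmorph_eq0 f) fbk k00 expr0n gtn_eqF ?prime_gt0.
  have [l [m [m0 bE]]] := kummer k b k_neq0 (esym fbk).
  have [/dvdnP[q lE]|/coprime_gt0/andP[l_gt0 l_co]] := boolP (p %| l)%N.
    by case: bNp; exists (a ^+ q * m); rewrite bE lE exprM exprMn.
  have [k' fck'] : exists k', f c = k' ^+ p.
    by apply: split_pth; apply: (symbol_split_expl a0 m0 l_gt0 l_co); rewrite -bE.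
  have k'0 : k' != 0.
    apply: contra_neq c0 => k'0; apply/eqP.
    by rewrite -(fmorph_eq0 f) fck' k'0 expr0n gtn_eqF ?prime_gt0.
  have [n [m' [m'0 cE]]] := kummer k' c k'0 (esym fck').
  have /(coprimeP _ l_gt0)[[u v] /= uv] := l_co.
  have uvE : (u * l = (v * p).+1)%N.
    by rewrite -[RHS]add1n -uv subnK // ltnW // -subn_gt0 uv.
  (* As [u l = v p + 1], [a] is [b^u] modulo [p]th powers, so [c], congruent to [a^n], is congruent
     to [b^(u n)]. *)
  exists (u * n)%N, (m' / (a ^+ (v * n) * m ^+ (u * n))); split.
    by rewrite !mulf_neq0 ?invr_eq0 ?mulf_neq0 ?expf_neq0.
  have aE : (a ^+ l) ^+ (u * n) = a ^+ n * (a ^+ (v * n)) ^+ p.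
    rewrite -!exprM -exprD; congr (a ^+ _).
    by rewrite mulnA (mulnC l) uvE mulSn mulnAC.
  have mE : (m ^+ p) ^+ (u * n) = (m ^+ (u * n)) ^+ p by rewrite -!exprM mulnC.
  rewrite bE exprMn aE mE cE expr_div_n exprMn; set x := _ ^+ p; set y := _ ^+ p.
  by field; rewrite !expf_neq0.
have [|j [d [d0 fcE]]] := K_rigid fbNp _ fbc; first by rewrite fmorph_eq0.
have [l [m [m0 eE]]] : exists l m, m != 0 /\ c / b ^+ j = a ^+ l * m ^+ p.
  apply: (kummer d) => //; rewrite fmorph_div rmorphXn fcE mulrC mulKf //.
  by rewrite expf_neq0 // fmorph_eq0.
have cE : c = b ^+ j * (a ^+ l * m ^+ p) by rewrite -eE mulrC divfK // expf_neq0.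
have [/dvdnP[q lE]|/coprime_gt0/andP[l_gt0 l_co]] := boolP (p %| l)%N.
  by exists j, (a ^+ q * m); rewrite mulf_neq0 ?expf_neq0 // cE lE exprM exprMn.
case: fbNp; apply: split_pth.
have bm0 : b ^+ j * m != 0 by rewrite mulf_neq0 ?expf_neq0.
apply: (symbol_split_expl a0 bm0 l_gt0 l_co); apply: symbol_splitC.
(* The exponent [j (p - 1)] stands for [-j]: it turns [c] into [a^l (b^j m)^p], whence
   [(b, a) = 0]. *)
have := symbol_split_mulr (j * p.-1) p_odd bc; congr symbol_split.
rewrite cE exprMn -exprM.
have -> : (j * p = j + j * p.-1)%N by rewrite -mulnS prednK ?prime_gt0.
by rewrite exprD; ring.
Qed.

End Descent.

(** * Descent along a Galois extension *)

Section SubfieldMorphism.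

Variables (F : fieldType) (L : fieldExtType F) (K E : {subfield L}).
Variables (g : {rmorphism L -> L}) (g_stable : forall u, u \in K -> g u \in E).

(* The stability proof is kept as an argument so that the morphism structure
   below can be inferred. *)
Definition subvs_rmorph (u : subvs_of K) : subvs_of E :=
  let _ := g_stable in vsproj E (g (vsval u)).

Lemma val_subvs_rmorph u : vsval (subvs_rmorph u) = g (vsval u).
Proof. by rewrite /subvs_rmorph vsprojK ?g_stable ?subvsP. Qed.

Fact subvs_rmorph_zmod : zmod_morphism subvs_rmorph.
Proof. by move=> u v; apply: val_inj; rewrite /= !val_subvs_rmorph rmorphB. Qed.

Fact subvs_rmorph_monoid : monoid_morphism subvs_rmorph.
Proof.
split=> [|u v]; apply: val_inj; rewrite /= !val_subvs_rmorph; first by rewrite /= !algid1 rmorph1.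
by rewrite -rmorphM.
Qed.

HB.instance Definition _ :=
  GRing.isZmodMorphism.Build (subvs_of K) (subvs_of E) subvs_rmorph subvs_rmorph_zmod.
HB.instance Definition _ :=
  GRing.isMonoidMorphism.Build (subvs_of K) (subvs_of E) subvs_rmorph subvs_rmorph_monoid.

End SubfieldMorphism.

Lemma fixedField_gen (F : fieldType) (L : splittingFieldType F) (E : {subfield L})
  (A : {set gal_of E}) : fixedField <<A>>%g = fixedField A.
Proof.
apply/eqP; rewrite eqEsubv fixedFieldS ?subset_gen //=.
by rewrite -galois_connection ?fixedField_bound // gen_subG galois_connection_subset.
Qed.

(** Normalizers grow in a [p]-group: take [y] in the normalizer outside [H], then the last [y^(p^k)]
    still outside [H]. *)
Lemma norm_step_elt (gT : finGroupType) (p : nat) (G H : {group gT}) :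
    prime p -> (p.-group G)%g -> H \proper G ->
  exists x, [/\ x \in G, x \in 'N(H)%g, x \notin H & (x ^+ p)%g \in H].
Proof.
move=> p_pr pG sHG; have /properP[sHN [y yN yH]] := nilpotent_proper_norm (pgroup_nil pG) sHG.
have /setIP[yG yNH] := yN.
have yp : exists k, (y ^+ (p ^ k))%g \in H.
  have /p_natP[k yk] := mem_p_elt pG yG.
  by exists k; rewrite -yk expg_order group1.
case: (ex_minnP yp) => -[|k] yk_in kmin; first by rewrite expg1 (negPf yH) in yk_in.
exists (y ^+ (p ^ k))%g; split; [exact: groupX | exact: groupX | | by rewrite -expgnA -expnSr].
by apply/negP => /kmin; rewrite ltnn.
Qed.

Section GaloisDescent.

Variables (p : nat) (F : fieldType) (L : splittingFieldType F) (z : F).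
Hypotheses (p_pr : prime p) (p_odd : odd p) (z_prim : p.-primitive_root z).
Hypothesis L_gal : galois 1%VS {:L}.
Hypothesis L_p : p.-nat (\dim {:L}).

Local Notation G := 'Gal({:L} / 1%AS)%G.
Implicit Type H : {group gal_of {:L}}.

Lemma subvs_prim_root (K : {subfield L}) : p.-primitive_root (z%:A : subvs_of K).
Proof. by rewrite (fmorph_primitive_root (in_alg (subvs_of K))). Qed.

(** Normalizing [H], [x] acts on the fixed field of [H], with [p]th power trivial since [x^p] lies
    in [H]; its fixed elements are those of the group generated by [x] and [H]. *)
Lemma rigid_fixedField_norm H x :
    x \in 'N(H)%g -> (x ^+ p)%g \in H ->
    symbol_rigid p (subvs_of (fixedField_aspace H)) ->
  symbol_rigid p (subvs_of (fixedField_aspace <<x |: H>>%g)).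
Proof.
move=> xN xp rigH.
have s_st u : u \in fixedField_aspace H -> x u \in fixedField_aspace H.
  move=> uH; have [_ fixu] := mem_fixedFieldP uH.
  apply/fixedFieldP; rewrite ?memvf // => h hH.
  rewrite -galM ?memvf // (conjgCV x h) galM ?memvf // fixu //.
  by rewrite memJ_norm // groupV.
have f_st u : u \in fixedField_aspace <<x |: H>>%g -> idfun u \in fixedField_aspace H.
  by apply/subvP/fixedFieldS/(subset_trans _ (subset_gen _))/subsetUr.
pose s := subvs_rmorph s_st; pose f := subvs_rmorph f_st.
apply: (rigid_descent (f := f) (s := s) p_pr p_odd (subvs_prim_root _)) => //.
- move=> u; apply: val_inj; rewrite /= !val_subvs_rmorph /=.
  have /mem_fixedFieldP[_ -> //] := subvsP u.
  by rewrite mem_gen ?setU11.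
- move=> u su; have uH' : vsval u \in fixedField_aspace <<x |: H>>%g.
    rewrite /= fixedField_gen; apply/fixedFieldP; rewrite ?memvf // => h.
    case/setU1P => [->|hH]; first by rewrite -[RHS](congr1 vsval su) val_subvs_rmorph.
    by have /mem_fixedFieldP[_ ->] := subvsP u.
  exists (vsproj _ (vsval u)); apply: val_inj.
  by rewrite /= val_subvs_rmorph /= vsprojK.
- move=> u; have iterE k : vsval (iter k s u) = (x ^+ k)%g (vsval u).
    elim: k => [|k IHk]; first by rewrite gal_id.
    by rewrite iterS /= val_subvs_rmorph /= IHk expgSr galM ?memvf.
  apply: val_inj; rewrite [LHS]iterE.
  by have /mem_fixedFieldP[_ ->] := subvsP u.
Qed.

Lemma rigid_fixedField_base H :
  H \subset G -> symbol_rigid p (subvs_of (fixedField_aspace H)) -> symbol_rigid p F.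
Proof.
have [n] := ubnP (#|G| - #|H|); elim: n H => // n IHn H le_n sHG rigH.
have [HG|] := eqVproper sHG.
  (* Here the fixed field is a copy of [F]; descent along the identity carries rigidity over. *)
  pose f : {rmorphism F -> subvs_of (fixedField_aspace H)} := in_alg _.
  apply: (rigid_descent (f := f) (s := idfun) p_pr p_odd z_prim) => //.
    move=> u _; have : vsval u \in 1%VS.
      by rewrite -[1%VS](galois_fixedField L_gal) -HG; apply: subvsP.
    by case/vlineP => c uc; exists c; apply: val_inj; rewrite /= uc algid1.
  by move=> k; elim: (p).
have pG : (p.-group G)%g by rewrite /pgroup -(galois_dim L_gal) dimv1 divn1.
move/(norm_step_elt p_pr pG) => [x [xG xN xH xp]].
apply: (IHn <<x |: H>>%G); last exact: rigid_fixedField_norm.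
  have ltH : (#|H| < #|<<x |: H>>%g|)%N.
    apply/proper_card/properP; split; first by rewrite (subset_trans _ (subset_gen _)) ?subsetUr.
    by exists x; rewrite // mem_gen ?setU11.
  rewrite -ltnS (leq_trans _ le_n) // ltnS ltn_sub2l //.
  by rewrite (leq_trans ltH) // subset_leq_card // gen_subG subUset sub1set xG.
by rewrite gen_subG subUset sub1set xG.
Qed.

End GaloisDescent.

Theorem theorem4p15 (p : nat) (F : fieldType) :
  prime p -> odd p ->
  (exists z : F, p.-primitive_root z) ->
  GFp_fin_gen p F ->
  (exists (L : splittingFieldType F) (K : {subfield L}),
      finite_Galois_p_ext p L /\ p_rigid p (subvs_of K)) ->
  p_rigid p F.
Proof.
move=> p_pr p_odd [z z_prim] _ [L [K [[L_gal L_p] K_rigid]]].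
apply: (symbol_rigid_p_rigid p_pr z_prim).
have K_gal : galois K {:L} by apply: galoisS L_gal; rewrite sub1v subvf.
(* The descent enlarges subgroups, so [K] is presented as a fixed field. *)
have KE : K = fixedField_aspace 'Gal({:L} / K)%g.
  by apply: val_inj; rewrite /= (galois_fixedField K_gal).
rewrite KE in K_rigid.
apply: (rigid_fixedField_base p_pr p_odd z_prim L_gal L_p (H := 'Gal({:L} / K)%G)).
  by rewrite galS ?sub1v.
exact: p_rigid_symbol_rigid.
Qed.
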